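(* Let $\rho,\sigma,\eta$ be 1-arrows from $A$ to $B$ in a 2-$C^*$-category closed under projections, direct sums and conjugation, and fix solutions of the conjugation equations for $\rho$ and for $\eta$, with the induced Hilbert bundle structures on $\mathrm{Hom}(\rho,\sigma)$, $\mathrm{Hom}(\eta,\rho)$ and $\mathrm{Hom}(\eta,\sigma)$ over $\Omega_A$. Let $\omega\in\Omega_A$. If $T,T'\in\mathrm{Hom}(\rho,\sigma)$ satisfy $T_{|\omega}=T'_{|\omega}$ and $P,P'\in\mathrm{Hom}(\eta,\rho)$ satisfy $P_{|\omega}=P'_{|\omega}$, then $(T\circ P)_{|\omega}=(T'\circ P)_{|\omega}=(T\circ P')_{|\omega}=(T'\circ P')_{|\omega}$.
   Context: A 2-$C^*$-category is a strict 2-category (1-arrows $B\xleftarrow{\rho}A$ composed by $\otimes$, with unit 1-arrows $\iota_A$; 2-arrows $S\in\mathrm{Hom}(\rho,\sigma)$ between parallel 1-arrows, with vertical composition $\circ$, units $1_\rho$, and horizontal composition $\otimes$; $\mathrm{End}(\rho)=\mathrm{Hom}(\rho,\rho)$) such that every $\mathrm{Hom}(\rho,\sigma)$ is a complex Banach space, compositions are bilinear, there is an antilinear involution $*:\mathrm{Hom}(\rho,\sigma)\to\mathrm{Hom}(\sigma,\rho)$ with $(S\circ T)^*=T^*\circ S^*$ and $(S\otimes T)^*=S^*\otimes T^*$, $\|T\circ S\|\le\|T\|\|S\|$, $\|S^*\circ S\|=\|S\|^2$, and $S^*\circ S$ is positive in $\mathrm{End}(\rho)$ for $S\in\mathrm{Hom}(\rho,\sigma)$.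 $\mathrm{End}(\iota_A)$ is commutative, identified with $C(\Omega_A)$, $\Omega_A$ compact Hausdorff. Closed under projections: for each projection $P\in\mathrm{End}(\rho)$ there are a 1-arrow $\rho_P$ and $W\in\mathrm{Hom}(\rho_P,\rho)$ with $W^*\circ W=1_{\rho_P}$, $W\circ W^*=P$; direct sums of parallel 1-arrows exist, given by isometries. Closed under conjugation: for each $B\xleftarrow{\rho}A$ there are $A\xleftarrow{\bar\rho}B$ and $R_\rho\in\mathrm{Hom}(\iota_A,\bar\rho\otimes\rho)$, $\bar R_\rho\in\mathrm{Hom}(\iota_B,\rho\otimes\bar\rho)$ (a solution of the conjugation equations) with $(\bar R_\rho^*\otimes1_\rho)\circ(1_\rho\otimes R_\rho)=1_\rho$, $(R_\rho^*\otimes1_{\bar\rho})\circ(1_{\bar\rho}\otimes\bar R_\rho)=1_{\bar\rho}$. Hilbert bundle structure: for a solution $R_\rho,\bar R_\rho$ for $\rho$ and $T,S\in\mathrm{Hom}(\rho,\sigma)$, $\langle T,S\rangle=R_\rho^*\circ(1_{\bar\rho}\otimes(S^*\circ T))\circ R_\rho\in C(\Omega_A)$; the fibre $\mathrm{Hom}(\rho,\sigma)_\omega$ is the separated completion of $\mathrm{Hom}(\rho,\sigma)$ for the semi-inner product $\langle\cdot,\cdot\rangle(\omega)$, and $T_{|\omega}$ is the image of $T$; thus $T_{|\omega}=T'_{|\omega}$ iff $\langle T-T',T-T'\rangle(\omega)=0$. *)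

(* Defs.v *)
From HB Require Import structures.
From mathcomp Require Import all_boot all_order all_algebra.
From mathcomp Require Import all_classical all_reals all_analysis.
From mathcomp Require Export complex.

Set Implicit Arguments.
Unset Strict Implicit.
Unset Printing Implicit Defensive.

Import Order.TTheory GRing.Theory Num.Theory.
Import numFieldNormedType.Exports.

Local Open Scope classical_set_scope.
Local Open Scope complex_scope.
Local Open Scope ring_scope.

Declare Scope two_cat_scope.
Delimit Scope two_cat_scope with C2.
Local Open Scope two_cat_scope.

(* 1-arrows B <-r- A are the elements of [arr A B]; they compose from right to
   left.  Strictness: associativity and unitality are equalities. *)
Record one_category := OneCategory {
  obj :> Type;
  arr : obj -> obj -> Type;
  unit1 : forall A, arr A A;
  comp1 : forall A B C, arr B C -> arr A B -> arr A C;
  comp1A : forall A B C D (r : arr C D) (s : arr B C) (t : arr A B),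
    comp1 r (comp1 s t) = comp1 (comp1 r s) t;
  comp1L : forall A B (r : arr A B), comp1 (unit1 B) r = r;
  comp1R : forall A B (r : arr A B), comp1 r (unit1 A) = r
}.
Arguments arr {_}.
Arguments unit1 {_}.
Arguments comp1 {_ A B C}.
Arguments comp1A {_ A B C D}.
Arguments comp1L {_ A B}.
Arguments comp1R {_ A B}.

Notation "r ⋆ s" := (comp1 r s)
  (at level 40, left associativity) : two_cat_scope.

Record two_ops (R : realType) (K : one_category) := TwoOps {
  Hom2 : forall A B : K, arr A B -> arr A B -> completeNormedModType R[i];
  id2 : forall (A B : K) (r : arr A B), Hom2 r r;
  vcomp : forall (A B : K) (r s t : arr A B), Hom2 s t -> Hom2 r s -> Hom2 r t;
  hcomp : forall (A B C : K) (r r' : arr B C) (s s' : arr A B),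
    Hom2 r r' -> Hom2 s s' -> Hom2 (r ⋆ s) (r' ⋆ s');
  star : forall (A B : K) (r s : arr A B), Hom2 r s -> Hom2 s r
}.
Arguments Hom2 {R K} t {A B} : rename.
Arguments id2 {R K} {t A B} : rename.
Arguments vcomp {R K t0 A B r s t} : rename.
Arguments hcomp {R K t A B C r r' s s'} : rename.
Arguments star {R K t A B r s} : rename.

Notation "S ∘ T" := (vcomp S T)
  (at level 40, left associativity) : two_cat_scope.
Notation "S ⊗ T" := (hcomp S T)
  (at level 40, left associativity) : two_cat_scope.
Notation "S ^†" := (star S) (at level 2, format "S ^†") : two_cat_scope.

Section TwoOps.
Context {R : realType} {K : one_category} {H : two_ops R K}.

(* In a strict 2-category Hom(r, s) and Hom(r', s') are the same space when
   r = r' and s = s'; in type theory the identification is a transport. *)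
Definition castHom (A B : K) (r r' s s' : arr A B) (er : r = r') (es : s = s')
    (S : Hom2 H r s) : Hom2 H r' s' :=
  eq_rect s (fun x => Hom2 H r' x) (eq_rect r (fun x => Hom2 H x s) S r' er)
    s' es.

Definition invertible2 (A B : K) (r : arr A B) (S : Hom2 H r r) : Prop :=
  exists S', S ∘ S' = id2 r /\ S' ∘ S = id2 r.

(* Positivity in the C*-algebra End(r): self-adjoint, with spectrum in
   [0, +oo[ (in R[i], [0 <= z] means that z is real and nonnegative). *)
Definition positive2 (A B : K) (r : arr A B) (S : Hom2 H r r) : Prop :=
  S^† = S /\ forall z : R[i], ~ invertible2 (S - z *: id2 r) -> 0 <= z.

End TwoOps.

Record two_cstar_axioms (R : realType) (K : one_category) (H : two_ops R K)
    : Prop := TwoCstarAxioms {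
  (* strict 2-category *)
  vcompA : forall (A B : K) (r s t u : arr A B)
    (S : Hom2 H t u) (T : Hom2 H s t) (U : Hom2 H r s),
    S ∘ (T ∘ U) = (S ∘ T) ∘ U;
  vcompL : forall (A B : K) (r s : arr A B) (S : Hom2 H r s), id2 s ∘ S = S;
  vcompR : forall (A B : K) (r s : arr A B) (S : Hom2 H r s), S ∘ id2 r = S;
  hcompA : forall (A B C D : K) (r r' : arr C D) (s s' : arr B C)
    (t t' : arr A B) (S : Hom2 H r r') (T : Hom2 H s s') (U : Hom2 H t t'),
    castHom (comp1A r s t) (comp1A r' s' t') (S ⊗ (T ⊗ U)) = (S ⊗ T) ⊗ U;
  hcompL : forall (A B : K) (r s : arr A B) (S : Hom2 H r s),
    castHom (comp1L r) (comp1L s) (id2 (unit1 B) ⊗ S) = S;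
  hcompR : forall (A B : K) (r s : arr A B) (S : Hom2 H r s),
    castHom (comp1R r) (comp1R s) (S ⊗ id2 (unit1 A)) = S;
  hcomp_id2 : forall (A B C : K) (r : arr B C) (s : arr A B),
    id2 r ⊗ id2 s = id2 (r ⋆ s) :> Hom2 H _ _;
  interchange : forall (A B C : K) (r r' r'' : arr B C) (s s' s'' : arr A B)
    (S' : Hom2 H r' r'') (S : Hom2 H r r') (T' : Hom2 H s' s'') (T : Hom2 H s s'),
    (S' ⊗ T') ∘ (S ⊗ T) = (S' ∘ S) ⊗ (T' ∘ T);
  (* bilinearity of both compositions *)
  vcomp_linearl : forall (A B : K) (r s t : arr A B) (a : R[i])
    (S S' : Hom2 H s t) (T : Hom2 H r s),
    (a *: S + S') ∘ T = a *: (S ∘ T) + S' ∘ T;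
  vcomp_linearr : forall (A B : K) (r s t : arr A B) (a : R[i])
    (S : Hom2 H s t) (T T' : Hom2 H r s),
    S ∘ (a *: T + T') = a *: (S ∘ T) + S ∘ T';
  hcomp_linearl : forall (A B C : K) (r r' : arr B C) (s s' : arr A B)
    (a : R[i]) (S S' : Hom2 H r r') (T : Hom2 H s s'),
    (a *: S + S') ⊗ T = a *: (S ⊗ T) + S' ⊗ T;
  hcomp_linearr : forall (A B C : K) (r r' : arr B C) (s s' : arr A B)
    (a : R[i]) (S : Hom2 H r r') (T T' : Hom2 H s s'),
    S ⊗ (a *: T + T') = a *: (S ⊗ T) + S ⊗ T';
  (* involution *)
  star_antilinear : forall (A B : K) (r s : arr A B) (a : R[i])
    (S T : Hom2 H r s), (a *: S + T)^† = Num.conj a *: S^† + T^†;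
  starK : forall (A B : K) (r s : arr A B) (S : Hom2 H r s), S^†^† = S;
  star_vcomp : forall (A B : K) (r s t : arr A B)
    (S : Hom2 H s t) (T : Hom2 H r s), (S ∘ T)^† = T^† ∘ S^†;
  star_hcomp : forall (A B C : K) (r r' : arr B C) (s s' : arr A B)
    (S : Hom2 H r r') (T : Hom2 H s s'), (S ⊗ T)^† = S^† ⊗ T^†;
  (* norm *)
  normr_vcomp : forall (A B : K) (r s t : arr A B)
    (T : Hom2 H s t) (S : Hom2 H r s), `|T ∘ S| <= `|T| * `|S|;
  cstar_identity : forall (A B : K) (r s : arr A B) (S : Hom2 H r s),
    `|S^† ∘ S| = `|S| ^+ 2;
  star_positive : forall (A B : K) (r s : arr A B) (S : Hom2 H r s),
    positive2 (S^† ∘ S)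
}.

Record two_cstar_category (R : realType) := TwoCstarCategory {
  one_cat :> one_category;
  two_cat_ops :> two_ops R one_cat;
  two_cat_ax : two_cstar_axioms two_cat_ops
}.
Arguments two_cat_ops {R}.

Section Closure.
Context {R : realType} (K : two_cstar_category R).

Definition projection2 (A B : K) (r : arr A B) (P : Hom2 K r r) : Prop :=
  P^† = P /\ P ∘ P = P.

Definition closed_under_projections : Prop :=
  forall (A B : K) (r : arr A B) (P : Hom2 K r r), projection2 P ->
  exists (rP : arr A B) (W : Hom2 K rP r), W^† ∘ W = id2 rP /\ W ∘ W^† = P.

Definition closed_under_direct_sums : Prop :=
  forall (A B : K) (r s : arr A B),
  exists (t : arr A B) (V : Hom2 K r t) (W : Hom2 K s t),
    [/\ V^† ∘ V = id2 r, W^† ∘ W = id2 s & V ∘ V^† + W ∘ W^† = id2 t].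

Record conj_solution (A B : K) (r : arr A B) := ConjSolution {
  conj1 : arr B A;
  conjR : Hom2 K (unit1 A) (conj1 ⋆ r);
  conjRbar : Hom2 K (unit1 B) (r ⋆ conj1);
  conj_eq : castHom erefl (comp1L r) (conjRbar^† ⊗ id2 r)
            ∘ castHom (comp1R r) (comp1A r conj1 r) (id2 r ⊗ conjR) = id2 r;
  conj_eqbar : castHom erefl (comp1L conj1) (conjR^† ⊗ id2 conj1)
            ∘ castHom (comp1R conj1) (comp1A conj1 r conj1)
                (id2 conj1 ⊗ conjRbar) = id2 conj1
}.

Definition closed_under_conjugation : Prop :=
  forall (A B : K) (r : arr A B), inhabited (conj_solution r).

(* The identification of End(iota_A) with C(Omega_A): a compact Hausdorff space
   and a *-isomorphism onto its continuous complex functions (isometric for the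
   sup norm, as is any *-isomorphism of C*-algebras). *)
Record spectrum (A : K) := Spectrum {
  Omega :> topologicalType;
  Omega_compact : compact [set: Omega];
  Omega_hausdorff : hausdorff_space Omega;
  ev : Hom2 K (unit1 A) (unit1 A) -> Omega -> R[i]^o;
  ev_continuous : forall f, continuous (ev f);
  ev_inj : injective ev;
  ev_surj : forall g : Omega -> R[i]^o, continuous g -> exists f, ev f = g;
  ev_linear : forall (a : R[i]) f g w, ev (a *: f + g) w = a * ev f w + ev g w;
  ev_mul : forall f g w, ev (f ∘ g) w = ev f w * ev g w;
  ev_one : forall w, ev (id2 (unit1 A)) w = 1;
  ev_star : forall f w, ev f^† w = Num.conj (ev f w)
}.

End Closure.
Arguments ev {R K A} s f w : rename.
Arguments conj_solution {R K A B} r.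
Arguments spectrum {R K} A.

Section HilbertBundle.
Context {R : realType} {K : two_cstar_category R} {A B : K} {r : arr A B}.

Definition inner (c : conj_solution r) (s : arr A B) (T S : Hom2 K r s)
    : Hom2 K (unit1 A) (unit1 A) :=
  (conjR c)^† ∘ (id2 (conj1 c) ⊗ (S^† ∘ T)) ∘ conjR c.

Context (c : conj_solution r) (G : spectrum A) (s : arr A B) (w : G).

Definition fibre_seminorm (T : Hom2 K r s) : R :=
  Num.sqrt (complex.Re (ev G (inner c T T) w)).

Definition fibre_cauchy (u : nat -> Hom2 K r s) : Prop :=
  forall e : R, 0 < e -> exists N : nat, forall m n : nat,
    (N <= m)%N -> (N <= n)%N -> fibre_seminorm (u m - u n) < e.

Definition fibre_equiv (u v : nat -> Hom2 K r s) : Prop :=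
  (fun n => fibre_seminorm (u n - v n)) @ \oo --> (0 : R).

Definition fibre_class (u : nat -> Hom2 K r s) : set (nat -> Hom2 K r s) :=
  [set v | fibre_cauchy v /\ fibre_equiv u v].

(* The fibre Hom(r, s)_w: separated completion of Hom(r, s), as equivalence
   classes of Cauchy sequences. *)
Definition fibre : Type :=
  {X : set (nat -> Hom2 K r s) | exists2 u, fibre_cauchy u & X = fibre_class u}.

Lemma fibre_seminorm0 : fibre_seminorm 0 = 0.
Proof.
have ax := two_cat_ax K.
have v0 (p q t : arr A A) (S : Hom2 K q t) : S ∘ (0 : Hom2 K p q) = 0.
  by have := vcomp_linearr ax (-1) S 0 (0 : Hom2 K p q);
     rewrite !scaleN1r oppr0 addr0 addNr.
have v0' (p q t : arr A A) (S : Hom2 K p q) : (0 : Hom2 K q t) ∘ S = 0.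
  by have := vcomp_linearl ax (-1) 0 (0 : Hom2 K q t) S;
     rewrite !scaleN1r oppr0 addr0 addNr.
have w0 (S : Hom2 K s r) : S ∘ (0 : Hom2 K r s) = 0.
  by have := vcomp_linearr ax (-1) S 0 (0 : Hom2 K r s);
     rewrite !scaleN1r oppr0 addr0 addNr.
have h0 : id2 (conj1 c) ⊗ (0 : Hom2 K r r) = 0.
  by have := hcomp_linearr ax (-1) (id2 (conj1 c)) 0 (0 : Hom2 K r r);
     rewrite !scaleN1r oppr0 addr0 addNr.
have e0 : ev G 0 w = 0.
  by have := ev_linear (s := G) (-1) 0 0 w;
     rewrite scaleN1r oppr0 addr0 mulN1r addNr.
by rewrite /fibre_seminorm /inner w0 h0 v0 v0' e0 sqrtr0.
Qed.

Lemma fibre_cauchy_cst (T : Hom2 K r s) : fibre_cauchy (fun=> T).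
Proof.
by move=> e e0; exists 0%N => m n _ _; rewrite subrr fibre_seminorm0.
Qed.

(* T |-> T_{|w}: the image in the completion, the class of the constant
   sequence T. *)
Definition restr (T : Hom2 K r s) : fibre :=
  exist _ (fibre_class (fun=> T))
    (ex_intro2 _ _ (fun=> T) (fibre_cauchy_cst T) erefl).

End HilbertBundle.

(* Main.v *)
Require Import Defs.
From HB Require Import structures.
From mathcomp Require Import all_boot all_order all_algebra.
From mathcomp Require Import all_classical all_reals all_analysis.
From mathcomp Require Import ring.
Local Open Scope two_cat_scope.

(** By the axioms, [(X, Y) |-> (X^† ∘ Y)(w)] is a positive semidefinite form on
    [Hom(ι_A, s)], and [<T, T>(w)] is its value at [(1 ⊗ T) ∘ R].  By
    Cauchy-Schwarz, if [Z] is null for this form then so is [E ∘ Z] for every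
    2-arrow [E]: indeed [(E ∘ Z)^† ∘ (E ∘ Z) = Z^† ∘ (E^† ∘ E ∘ Z)].  For
    [P] null, take [E = 1 ⊗ T].  For [T] null, Frobenius reciprocity writes
    [(1 ⊗ P) ∘ R_eta] as [(Q ⊗ 1) ∘ R_rho], so that
    [(1 ⊗ T ∘ P) ∘ R_eta = (Q ⊗ 1) ∘ (1 ⊗ T) ∘ R_rho], and [E = Q ⊗ 1] works. *)

Set Implicit Arguments.
Unset Strict Implicit.
Unset Printing Implicit Defensive.

Import Order.TTheory GRing.Theory Num.Theory.
Import numFieldNormedType.Exports.

Local Open Scope classical_set_scope.
Local Open Scope complex_scope.
Local Open Scope ring_scope.

(** * Equality of 2-arrows up to transport of their endpoints *)

Section HeterogeneousEquality.
Context {R : realType} {K : one_category} {H : two_ops R K}.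

Definition heq (A B : K) (r s r' s' : arr A B)
    (S : Hom2 H r s) (S' : Hom2 H r' s') : Prop :=
  exists (er : r = r') (es : s = s'), castHom er es S = S'.

Lemma heq_refl (A B : K) (r s : arr A B) (S : Hom2 H r s) : heq S S.
Proof. by exists erefl, erefl. Qed.

Lemma heq_eq (A B : K) (r s : arr A B) (S S' : Hom2 H r s) :
  heq S S' -> S = S'.
Proof.
by case=> er [es <-]; rewrite (Prop_irrelevance er erefl)
  (Prop_irrelevance es erefl).
Qed.

Lemma heq_sym (A B : K) (r s r' s' : arr A B)
    (S : Hom2 H r s) (S' : Hom2 H r' s') : heq S S' -> heq S' S.
Proof. by case=> er [es <-]; subst; apply: heq_refl. Qed.

Lemma heq_trans (A B : K) (r s r' s' r'' s'' : arr A B)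
    (S : Hom2 H r s) (S' : Hom2 H r' s') (S'' : Hom2 H r'' s'') :
  heq S S' -> heq S' S'' -> heq S S''.
Proof. by case=> er [es <-] [er' [es' <-]]; subst; apply: heq_refl. Qed.

Lemma heq_castl (A B : K) (r s r' s' : arr A B) (er : r = r') (es : s = s')
    (S : Hom2 H r s) : heq (castHom er es S) S.
Proof. by subst; apply: heq_refl. Qed.

Lemma heq_vcomp (A B : K) (r s t r' s' t' : arr A B)
    (S : Hom2 H s t) (T : Hom2 H r s) (S' : Hom2 H s' t') (T' : Hom2 H r' s') :
  heq S S' -> heq T T' -> heq (S ∘ T) (S' ∘ T').
Proof.
case=> es [et <-] [er [es' <-]]; rewrite (Prop_irrelevance es' es).
by subst; apply: heq_refl.
Qed.

Lemma heq_hcomp (A B C : K) (r r' p p' : arr B C) (s s' q q' : arr A B)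
    (S : Hom2 H r r') (T : Hom2 H s s') (S' : Hom2 H p p') (T' : Hom2 H q q') :
  heq S S' -> heq T T' -> heq (S ⊗ T) (S' ⊗ T').
Proof. by case=> er [es <-] [et [eu <-]]; subst; apply: heq_refl. Qed.

End HeterogeneousEquality.

(** * Consequences of the axioms, and Frobenius reciprocity *)

Section TwoCstar.
Context {R : realType} {K : two_cstar_category R}.
Let ax := two_cat_ax K.

Lemma heq_hcompA (A B C D : K) (r r' : arr C D) (s s' : arr B C)
    (t t' : arr A B) (S : Hom2 K r r') (T : Hom2 K s s') (U : Hom2 K t t') :
  heq (S ⊗ (T ⊗ U)) (S ⊗ T ⊗ U).
Proof. by rewrite -(hcompA ax); apply/heq_sym/heq_castl. Qed.

Lemma heq_hcompL (A B : K) (r s : arr A B) (S : Hom2 K r s) :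
  heq (id2 (unit1 B) ⊗ S) S.
Proof. by rewrite -[X in heq _ X](hcompL ax); apply/heq_sym/heq_castl. Qed.

Lemma heq_hcompR (A B : K) (r s : arr A B) (S : Hom2 K r s) :
  heq (S ⊗ id2 (unit1 A)) S.
Proof. by rewrite -[X in heq _ X](hcompR ax); apply/heq_sym/heq_castl. Qed.

Lemma star_id2 (A B : K) (r : arr A B) : (id2 r : Hom2 K r r)^† = id2 r.
Proof.
rewrite -[LHS](vcompR ax) -{2}[id2 r](starK ax) -(star_vcomp ax).
by rewrite (vcompR ax) (starK ax).
Qed.

Lemma vcompBl (A B : K) (r s t : arr A B) (S S' : Hom2 K s t) (T : Hom2 K r s) :
  (S - S') ∘ T = S ∘ T - S' ∘ T.
Proof. by rewrite addrC -scaleN1r (vcomp_linearl ax) scaleN1r addrC. Qed.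

Lemma vcompBr (A B : K) (r s t : arr A B) (S : Hom2 K s t) (T T' : Hom2 K r s) :
  S ∘ (T - T') = S ∘ T - S ∘ T'.
Proof. by rewrite addrC -scaleN1r (vcomp_linearr ax) scaleN1r addrC. Qed.

Lemma hcompBr (A B C : K) (r r' : arr B C) (s s' : arr A B)
    (S : Hom2 K r r') (T T' : Hom2 K s s') :
  S ⊗ (T - T') = S ⊗ T - S ⊗ T'.
Proof. by rewrite addrC -scaleN1r (hcomp_linearr ax) scaleN1r addrC. Qed.

(** Evaluation at [w] is a character, so [f(w)] is in the spectrum of [f]: an inverse [g] of
    [f - f(w) 1] would give [1 = 0 * g(w)]. *)
Lemma ev_ge0 (A : K) (G : spectrum A) (w : G) (f : Hom2 K (unit1 A) (unit1 A)) :
  positive2 f -> 0 <= (ev G f w : R[i]).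
Proof.
case=> _; apply=> -[g [fg _]].
have := ev_one (s := G) w; rewrite -fg ev_mul addrC -scaleNr ev_linear ev_one.
by rewrite mulr1 addNr mul0r => /eqP; rewrite eq_sym oner_eq0.
Qed.

(** Up to casts, [Q = (1_b ⊗ Rbar^†) ∘ (M ⊗ 1)]. In [(Q ⊗ 1) ∘ R], sliding [M] past [R] brings
    [Rbar^†] and [R] together under [1_b], where the first conjugation equation cancels them. *)
Lemma conj_solution_frobenius (A B : K) (r : arr A B) (c : conj_solution r)
    (b : arr B A) (M : Hom2 K (unit1 A) (b ⋆ r)) :
  exists Q : Hom2 K (conj1 c) b, (Q ⊗ id2 r) ∘ conjR c = M.
Proof.
pose L : Hom2 K (b ⋆ (r ⋆ conj1 c)) b :=
  castHom erefl (comp1R b) (id2 b ⊗ (conjRbar c)^†).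
pose N : Hom2 K (conj1 c) (b ⋆ (r ⋆ conj1 c)) :=
  castHom (comp1L (conj1 c)) (esym (comp1A b r (conj1 c)))
    (M ⊗ id2 (conj1 c)).
exists (L ∘ N); apply: heq_eq.
have hN : heq (N ⊗ id2 r) (M ⊗ id2 (conj1 c ⋆ r)).
  apply: heq_trans (heq_hcomp (heq_castl _ _ _) (heq_refl _)) _.
  by rewrite -(hcomp_id2 ax); apply/heq_sym/heq_hcompA.
have hL : heq (L ⊗ id2 r)
    (id2 b ⊗ castHom erefl (comp1L r) ((conjRbar c)^† ⊗ id2 r)).
  apply: heq_trans (heq_hcomp (heq_castl _ _ _) (heq_refl _)) _.
  apply: heq_trans (heq_sym (heq_hcompA _ _ _)) _.
  exact: heq_hcomp (heq_refl _) (heq_sym (heq_castl _ _ _)).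
have hNR : heq ((N ⊗ id2 r) ∘ conjR c)
    ((id2 b ⊗ castHom (comp1R r) (comp1A r (conj1 c) r) (id2 r ⊗ conjR c)) ∘ M).
  apply: heq_trans (heq_vcomp hN (heq_sym (heq_hcompL _))) _.
  (* Collapse to [M ⊗ R], then expand it in the other order, with [M] applied first. *)
  rewrite (Defs.interchange ax) (vcompR ax) (vcompL ax).
  rewrite -[X in heq (X ⊗ _) _](vcompL ax) -[X in heq (_ ⊗ X) _](vcompR ax).
  rewrite -(Defs.interchange ax); apply: heq_vcomp; last exact: heq_hcompR.
  rewrite -(hcomp_id2 ax); apply: heq_trans (heq_sym (heq_hcompA _ _ _)) _.
  exact: heq_hcomp (heq_refl _) (heq_sym (heq_castl _ _ _)).
rewrite -[id2 r](vcompL ax) -(Defs.interchange ax) -(vcompA ax).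
apply: heq_trans (heq_vcomp hL hNR) _.
rewrite (vcompA ax) (Defs.interchange ax) (conj_eq c) (vcompL ax) (hcomp_id2 ax).
by rewrite (vcompL ax); apply: heq_refl.
Qed.

(** * The semidefinite form at a point of the spectrum *)

Section Form.
Context {A : K} {G : spectrum A} (w : G).

(** Antilinear in [X] and linear in [Y], the opposite of the convention of [inner]; the two are
    compared only on the diagonal. *)
Definition form (s : arr A A) (X Y : Hom2 K (unit1 A) s) : R[i] :=
  ev G (X^† ∘ Y) w.

Variable s : arr A A.
Implicit Types X Y Z : Hom2 K (unit1 A) s.

Lemma formC X Y : form X Y = Num.conj (form Y X).
Proof. by rewrite /form -ev_star (star_vcomp ax) (starK ax). Qed.

Lemma form_ge0 X : 0 <= form X X.
Proof. exact/ev_ge0/(star_positive ax). Qed.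

Lemma form_linearr (a : R[i]) X Y Z :
  form X (a *: Y + Z) = a * form X Y + form X Z.
Proof. by rewrite /form (vcomp_linearr ax) ev_linear. Qed.

Lemma form_linearl (a : R[i]) X Y Z :
  form (a *: Y + Z) X = Num.conj a * form Y X + form Z X.
Proof. by rewrite formC form_linearr rmorphD rmorphM /= -(formC Y X) -(formC Z X). Qed.

Lemma form_null Z Y : form Z Z = 0 -> form Z Y = 0.
Proof.
move=> Z0; apply/eqP/contraT => b0; set b := form Z Y in b0.
have c0 := form_ge0 Y; set c := form Y Y in c0.
have n0 : 0 < b * Num.conj b by rewrite -normCK exprn_gt0 ?normr_gt0.
(* Chosen so that [t |b|^2 = c + 1]: if [b] were nonzero, the form would take the negative value
   [c - 2 t |b|^2 = - (c + 2)] at [Y - t b Z]. *)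
pose t := (c + 1) / (b * Num.conj b).
have tr : Num.conj t = t.
  by apply/CrealP/ger0_real/divr_ge0; [exact: addr_ge0 | exact: ltW].
have tb : t * (b * Num.conj b) = c + 1 by rewrite divfK ?gt_eqF.
have := form_ge0 (- (t * b) *: Z + Y).
rewrite form_linearr !form_linearl Z0 (formC Y Z) -/b -/c rmorphN rmorphM /= tr.
have -> : - (t * b) * (- (t * Num.conj b) * 0 + Num.conj b) +
    (- (t * Num.conj b) * b + c) = - (c + 2).
  by transitivity (c - 2 * (t * (b * Num.conj b))); [ring | rewrite tb; ring].
by rewrite oppr_ge0 lt_geF // ltr_wpDl.
Qed.

Lemma form_addNull Z Y : form Z Z = 0 -> form (Y - Z) (Y - Z) = form Y Y.
Proof.
move=> Z0; rewrite addrC -scaleN1r form_linearr !form_linearl (formC Y Z).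
by rewrite Z0 form_null // conjC0 !(mulr0, add0r).
Qed.

Lemma form_vcomp_null (t : arr A A) (E : Hom2 K s t) Z :
  form Z Z = 0 -> form (E ∘ Z) (E ∘ Z) = 0.
Proof.
move=> Z0; rewrite /form (star_vcomp ax) -(vcompA ax).
exact: form_null Z0.
Qed.

End Form.

(** The Frobenius transpose of [T]: it moves the fibre seminorm on [Hom(r, s)] to [form] on
    [Hom(ι_A, conj1 c ⋆ s)]. *)
Definition lift_conj (A B : K) (r s : arr A B) (c : conj_solution r)
    (T : Hom2 K r s) : Hom2 K (unit1 A) (conj1 c ⋆ s) :=
  (id2 (conj1 c) ⊗ T) ∘ conjR c.

Lemma lift_conjB (A B : K) (r s : arr A B) (c : conj_solution r)
    (T S : Hom2 K r s) : lift_conj c (T - S) = lift_conj c T - lift_conj c S.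
Proof. by rewrite /lift_conj hcompBr vcompBl. Qed.

Lemma lift_conj_vcomp (A B : K) (r s t : arr A B) (c : conj_solution r)
    (T : Hom2 K s t) (P : Hom2 K r s) :
  lift_conj c (T ∘ P) = (id2 (conj1 c) ⊗ T) ∘ lift_conj c P.
Proof.
by rewrite /lift_conj -[id2 _ in LHS](vcompL ax) -(Defs.interchange ax) (vcompA ax).
Qed.

(** * Null vectors of the fibre seminorm and their composites *)

Section Fibre.
Context {A B : K} {G : spectrum A} (w : G).

Definition null_at (r s : arr A B) (c : conj_solution r) (T : Hom2 K r s) :=
  form w (lift_conj c T) (lift_conj c T) = 0.

Lemma fibre_seminormE (r s : arr A B) (c : conj_solution r) (T : Hom2 K r s) :
  fibre_seminorm c w T =
  Num.sqrt (complex.Re (form w (lift_conj c T) (lift_conj c T))).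
Proof.
rewrite /fibre_seminorm /inner /form /lift_conj (star_vcomp ax).
rewrite (star_hcomp ax) star_id2 -[id2 (conj1 c) in LHS](vcompL ax).
by rewrite -(Defs.interchange ax) !(vcompA ax).
Qed.

(** The form is nonnegative in [R[i]] on the diagonal, so its imaginary part vanishes and taking the
    real part loses nothing. *)
Lemma fibre_seminorm_eq0 (r s : arr A B) (c : conj_solution r)
    (T : Hom2 K r s) : fibre_seminorm c w T = 0 <-> null_at c T.
Proof.
rewrite fibre_seminormE /null_at.
have := form_ge0 w (lift_conj c T); case: (form _ _ _) => x y.
rewrite lecE /= => /andP[/eqP -> x0]; split => [/eqP|[->]]; last exact: sqrtr0.
by rewrite sqrtr_eq0 => x0'; congr (_ +i* _); apply/le_anti; rewrite x0'.
Qed.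

Lemma fibre_seminorm_subr (r s : arr A B) (c : conj_solution r)
    (T S : Hom2 K r s) :
  null_at c S -> fibre_seminorm c w (T - S) = fibre_seminorm c w T.
Proof. by move=> S0; rewrite !fibre_seminormE lift_conjB form_addNull. Qed.

Lemma null_atN (r s : arr A B) (c : conj_solution r) (T : Hom2 K r s) :
  null_at c T -> null_at c (- T).
Proof.
move=> T0; apply/fibre_seminorm_eq0.
by rewrite -sub0r fibre_seminorm_subr // fibre_seminorm0.
Qed.

(** If the classes agree, the constant sequence [T'] lies in the class of [T], so a constant real
    sequence tends to [0]. Conversely, subtracting a null vector preserves the seminorm, so both
    constant sequences have the same equivalent Cauchy sequences. *)
Lemma restr_eqP (r s : arr A B) (c : conj_solution r) (T T' : Hom2 K r s) :
  restr c w T = restr c w T' <-> null_at c (T - T').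
Proof.
split=> [/(congr1 sval) /= e|TT'].
  have : fibre_class c w (fun=> T') (fun=> T').
    split; first exact: fibre_cauchy_cst.
    by rewrite /fibre_equiv subrr fibre_seminorm0; apply: cvg_cst.
  rewrite -e => -[_]; rewrite /fibre_equiv => h.
  by apply/fibre_seminorm_eq0; apply: cvg_unique h => //; apply: cvg_cst.
apply: eq_exist => /=; apply/seteqP.
have sub (X Y : Hom2 K r s) : null_at c (X - Y) ->
    fibre_class c w (fun=> X) `<=` fibre_class c w (fun=> Y).
  move=> XY v [cv]; rewrite /fibre_equiv => Xv; split => //.
  rewrite /fibre_equiv; under eq_fun => n.
    rewrite (_ : Y - v n = X - v n - (X - Y)); last first.
      by rewrite opprB [RHS]addrC addrA addrNK.
    by rewrite fibre_seminorm_subr //; over.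
  exact: Xv.
by split; apply: sub => //; rewrite -opprB; apply: null_atN.
Qed.

Lemma null_at_vcompr (r s t : arr A B) (c : conj_solution r)
    (T : Hom2 K s t) (P : Hom2 K r s) : null_at c P -> null_at c (T ∘ P).
Proof. by rewrite /null_at lift_conj_vcomp; apply: form_vcomp_null. Qed.

Lemma null_at_vcompl (r s t : arr A B) (c : conj_solution r)
    (d : conj_solution s) (T : Hom2 K s t) (P : Hom2 K r s) :
  null_at d T -> null_at c (T ∘ P).
Proof.
move=> T0; rewrite /null_at lift_conj_vcomp.
have [Q <-] := conj_solution_frobenius d (lift_conj c P).
rewrite (vcompA ax) (Defs.interchange ax) (vcompL ax) (vcompR ax).
(* Split [Q ⊗ T] with [T] applied first, which exposes [lift_conj d T]. *)
rewrite -[Q](vcompR ax) -[T](vcompL ax) -(Defs.interchange ax) -(vcompA ax).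
exact: form_vcomp_null.
Qed.

End Fibre.
End TwoCstar.

Theorem proposition2p3 (R : realType) (K : two_cstar_category R)
  (hproj : closed_under_projections K)
  (hsum : closed_under_direct_sums K)
  (hconj : closed_under_conjugation K)
  (A B : K) (rho sigma eta : arr A B)
  (crho : conj_solution rho) (ceta : conj_solution eta)
  (Omega_A : spectrum A) (omega : Omega_A)
  (T T' : Hom2 K rho sigma) (P P' : Hom2 K eta rho)
  (hT : restr crho omega T = restr crho omega T')
  (hP : restr ceta omega P = restr ceta omega P') :
  [/\ restr ceta omega (T ∘ P) = restr ceta omega (T' ∘ P),
      restr ceta omega (T' ∘ P) = restr ceta omega (T ∘ P')
    & restr ceta omega (T ∘ P') = restr ceta omega (T' ∘ P')].
Proof.
(* Stated for every [X], as it serves for both [P] and [P']. *)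
have vT X : restr ceta omega (T ∘ X) = restr ceta omega (T' ∘ X).
  apply/restr_eqP; rewrite -vcompBl.
  by apply: (null_at_vcompl ceta (d := crho)); apply/restr_eqP.
have vP : restr ceta omega (T ∘ P) = restr ceta omega (T ∘ P').
  by apply/restr_eqP; rewrite -vcompBr; apply/null_at_vcompr/restr_eqP.
by split; [exact: vT | rewrite -vT | exact: vT].
Qed.
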